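(* Let $k$ be a field, let $n\ge1$ and let $f=(f_1,\ldots,f_n)\in \mathrm{End}(\mathbb{A}^n)$ be a dominant endomorphism of $\mathbb{A}^n=\mathbb{A}^n_k$. For each $\mu=(\mu_1,\ldots,\mu_n)\in (\mathbb{R}_{> 0})^n$ the following hold: (1) $\theta := \deg_\mu(f) < \infty$. (2) The dynamical degree of $f$ satisfies $1 \leq \lambda(f)\le \theta$. (3) Let $g \in \mathrm{End}(\mathbb{A}^n)$ be the $\mu$-leading part of $f$. If $\theta > 1$, then \[ \lambda(f)=\theta \iff f \text{ is $\mu$-algebraically stable} \iff g^r\neq 0 \text{ for each } r\ge 1. \]
   Context: An endomorphism of $\mathbb{A}^n=\mathbb{A}^n_k$ is a tuple $f=(f_1,\ldots,f_n)\in k[x_1,\ldots,x_n]^n$, with composition $(f\circ g)_i=f_i(g_1,\ldots,g_n)$; $f^r$ is the $r$-fold iterate. $\deg(f)=\max_i \deg(f_i)$, and for dominant $f$ the dynamical degree is $\lambda(f)=\lim_{r\to\infty}\deg(f^r)^{1/r}$ (the limit exists). An endomorphism is $0$ if all its components are zero polynomials. For $\mu=(\mu_1,\ldots,\mu_n)\in(\mathbb{R}_{\ge0})^n\setminus\{0\}$, the degree function $\deg_\mu$ on $k[x_1,\ldots,x_n]$ is given by $\deg_\mu(0)=-\infty$ and, for $p\ne0$, $\deg_\mu(p)=\max\{\sum_i a_i\mu_i\}$ over all exponents $(a_1,\ldots,a_n)\in\mathbb{N}^n$ of monomials appearing in $p$ with nonzero coefficient. A polynomial is $\mu$-homogeneous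 of degree $\theta$ if it is a finite sum of monomials of $\mu$-degree $\theta$ (the zero polynomial is $\mu$-homogeneous of every degree); the $\mu$-homogeneous part of $q$ of degree $\theta$ is the sum of the monomial terms of $q$ of $\mu$-degree $\theta$. For a nonzero $f\in\mathrm{End}(\mathbb{A}^n)$, $\deg_\mu(f)=\inf\{\theta\in\mathbb{R}_{\ge0}\mid \deg_\mu(f_i)\le\theta\mu_i\text{ for all }i\}$, with $\deg_\mu(f)=\infty$ if this set is empty. $f$ is $\mu$-algebraically stable if $\deg_\mu(f)<\infty$ and $\deg_\mu(f^r)=\deg_\mu(f)^r$ for each $r\ge1$. If $f$ is dominant and $\deg_\mu(f)=\theta<\infty$, the $\mu$-leading part of $f$ is $g=(g_1,\ldots,g_n)$, where $g_j$ is the $\mu$-homogeneous part of $f_j$ of degree $\theta\mu_j$. *)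

(* Defs.v *)
(* mpoly has to be imported before MathComp-Analysis: in the other order their
   notation levels clash. *)
From mathcomp Require Import all_boot all_order all_algebra.
From mathcomp Require Import mpoly.
From mathcomp Require Import all_classical all_reals all_analysis.

Set Implicit Arguments.
Unset Strict Implicit.
Unset Printing Implicit Defensive.

Import Order.TTheory GRing.Theory Num.Theory.

Local Open Scope classical_set_scope.
Local Open Scope ring_scope.

Section Endomorphisms.
Variables (k : fieldType) (n : nat).

Definition endo := n.-tuple {mpoly k[n]}.

Definition endo_id : endo := [tuple 'X_i | i < n].

Definition endo_comp (f g : endo) : endo := [tuple tnth f i \mPo g | i < n].

Definition endo_iter (f : endo) (r : nat) : endo :=
  iter r (endo_comp f) endo_id.

Definition endo_is0 (f : endo) : Prop := forall i : 'I_n, tnth f i = 0.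

(* [msize p] is 1 + the total degree of p for p != 0; zero components count as
   having degree 0, but no iterate of a dominant f has one. *)
Definition endo_degree (f : endo) : nat :=
  (\max_(i < n) (msize (tnth f i)).-1)%N.

(* The points of the scheme A^n = Spec k[x_1, ..., x_n]. *)
Definition affine_space : set {pred {mpoly k[n]}} :=
  [set P | idealr_closed P /\ prime_idealr_closed P].

(* The Zariski closed subset V(S); every closed subset has this form. *)
Definition zero_locus (S : set {mpoly k[n]}) : set {pred {mpoly k[n]}} :=
  [set P | affine_space P /\ forall p, S p -> p \in P].

(* f acts on points by P |-> (f^* )^-1(P), where f^* is p |-> p \mPo f. *)
Definition endo_point (f : endo) (P : {pred {mpoly k[n]}}) :
    {pred {mpoly k[n]}} :=
  [pred p | p \mPo f \in P].

(* The image of f is Zariski dense. *)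
Definition dominant (f : endo) : Prop :=
  forall S : set {mpoly k[n]},
    endo_point f @` affine_space `<=` zero_locus S ->
    affine_space `<=` zero_locus S.

End Endomorphisms.

Section Degrees.
Variables (R : realType) (k : fieldType) (n : nat).

(* The term at r = 0 is irrelevant to the limit, which exists for dominant f. *)
Definition dynamical_degree (f : endo k n) : R :=
  limn (fun r : nat => (endo_degree (endo_iter f r))%:R `^ r%:R^-1).

Variable mu : 'I_n -> R.

Definition monomial_degree (m : 'X_{1..n}) : R :=
  \sum_(i < n) (m i)%:R * mu i.

(* The empty maximum gives degree -oo to the zero polynomial. *)
Definition mu_degree (p : {mpoly k[n]}) : \bar R :=
  \big[Order.max/-oo%E]_(m <- msupp p) (monomial_degree m)%:E.

Definition mu_homogeneous_part (t : R) (q : {mpoly k[n]}) : {mpoly k[n]} :=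
  \sum_(m <- msupp q | monomial_degree m == t) q@_m *: 'X_[m].

(* [ereal_inf set0 = +oo]. *)
Definition endo_mu_degree (f : endo k n) : \bar R :=
  ereal_inf [set t%:E | t in
    [set t : R | 0 <= t /\
      forall i : 'I_n, (mu_degree (tnth f i) <= (t * mu i)%:E)%E]].

Definition mu_algebraically_stable (f : endo k n) : Prop :=
  (endo_mu_degree f < +oo)%E /\
  forall r : nat, (1 <= r)%N ->
    endo_mu_degree (endo_iter f r) = (endo_mu_degree f ^+ r)%E.

(* Meaningful when [endo_mu_degree f] is finite. *)
Definition mu_leading_part (f : endo k n) : endo k n :=
  [tuple mu_homogeneous_part (fine (endo_mu_degree f) * mu j) (tnth f j)
     | j < n].

End Degrees.

(* Main.v *)
Require Import Defs.
From mathcomp Require Import all_boot all_order all_algebra.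
From mathcomp Require Import mpoly.
From mathcomp Require Import all_classical all_reals all_analysis.

(* Leading parts are compatible with composition, so the top-degree part of the
   r-th iterate with respect to the bound theta^r is exactly g^r; it vanishes
   precisely when that bound is not attained.  As all weights are positive, the
   weighted degree and the ordinary degree of an endomorphism differ by bounded
   factors, so they have the same exponential growth rate.  By Fekete's lemma
   lambda is the largest x with x^r <= deg(f^r) for all r >= 1.  If the weighted
   degree of a single iterate f^s is t, then deg(f^(s m)) <= C t^m for all m,
   whence lambda^s <= t: this forces stability when lambda = theta.  Conversely
   theta^r <= C deg(f^r) for all r forces theta <= lambda. *)

Set Implicit Arguments.
Unset Strict Implicit.
Unset Printing Implicit Defensive.

Import Order.TTheory GRing.Theory Num.Theory.
Import numFieldNormedType.Exports.

Local Open Scope ring_scope.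

(** * Weighted degrees and leading parts under products and composition *)

Section WeightedDegrees.
Variables (R : realType) (k : fieldType) (n : nat) (mu : 'I_n -> R).
Implicit Types (p q h : {mpoly k[n]}) (P Q : R -> Prop) (f g : endo k n).

Local Notation deg := (monomial_degree mu).

(** A general predicate [P] lets the conditions of being homogeneous of degree t, of degree below t
    and of degree at most t share the same closure lemmas; the zero polynomial satisfies all of
    them. *)
Definition degrees_in P p := forall m, m \in msupp p -> P (deg m).

Lemma monomial_degreeD (m1 m2 : 'X_{1..n}) :
  deg (m1 + m2)%MM = deg m1 + deg m2.
Proof.
rewrite -big_split /=; apply: eq_bigr => i _.
by rewrite mnmDE natrD mulrDl.
Qed.

Lemma degrees_inW P Q p :
  (forall x, P x -> Q x) -> degrees_in P p -> degrees_in Q p.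
Proof. by move=> PQ hp m /hp /PQ. Qed.

Lemma degrees_in0 P : degrees_in P 0.
Proof. by move=> m; rewrite msupp0. Qed.

Lemma degrees_inD P p q :
  degrees_in P p -> degrees_in P q -> degrees_in P (p + q).
Proof. by move=> hp hq m /msuppD_le; rewrite mem_cat => /orP[/hp|/hq]. Qed.

Lemma degrees_inZ P c p : degrees_in P p -> degrees_in P (c *: p).
Proof. by move=> hp m /msuppZ_le /hp. Qed.

Lemma degrees_in_sum P (I : eqType) (s : seq I) (F : I -> {mpoly k[n]}) :
  (forall i, i \in s -> degrees_in P (F i)) ->
  degrees_in P (\sum_(i <- s) F i).
Proof.
move=> hF; rewrite big_seq; elim/big_ind: _ => //.
- exact: degrees_in0.
- exact: degrees_inD.
Qed.

Lemma degrees_inM P Q S p q :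
  (forall x y, P x -> Q y -> S (x + y)) ->
  degrees_in P p -> degrees_in Q q -> degrees_in S (p * q).
Proof.
move=> PQS hp hq m /msuppM_le /allpairsP[[m1 m2] /= [/hp h1 /hq h2 ->]].
by rewrite monomial_degreeD; apply: PQS.
Qed.

(* Here [t] is only an upper bound for the degree of [p], so [h] may be 0: this
   is what makes the relation stable under composition and iteration. *)
Definition mu_lead t p h :=
  degrees_in (eq^~ t) h /\ degrees_in (fun x => x < t) (p - h).

Lemma mu_lead_le t p h : mu_lead t p h -> degrees_in (fun x => x <= t) p.
Proof.
move=> [hh hph]; rewrite -(subrK h p); apply: degrees_inD.
  by apply: degrees_inW hph => x /ltW.
by apply: degrees_inW hh => x ->.
Qed.

Lemma mu_lead_homogeneous_part t p :
  degrees_in (fun x => x <= t) p -> mu_lead t p (mu_homogeneous_part mu t p).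
Proof.
move=> hp; rewrite /mu_homogeneous_part; split.
  rewrite -big_filter; apply: degrees_in_sum => m.
  rewrite mem_filter => /andP[/eqP mt _]; apply: degrees_inZ => m'.
  by move/mem_msuppXP => <-.
rewrite {1}(mpolyE p) (bigID (fun m => deg m == t)) /= addrAC subrr add0r.
rewrite -big_filter; apply: degrees_in_sum => m.
rewrite mem_filter => /andP[mt /hp mlet]; apply: degrees_inZ => m'.
by move/mem_msuppXP => <-; rewrite lt_neqAle mt.
Qed.

(** As p - h lives in degrees below t, p and h have the same coefficients in degree t, and h has no
    others. *)
Lemma mu_lead_neq0 t p h :
  mu_lead t p h -> h <> 0 <-> exists2 m, m \in msupp p & deg m = t.
Proof.
move=> [hh hph].
have coefE m : deg m = t -> p@_m = h@_m.
  move=> mt; apply/eqP; rewrite -subr_eq0 -mcoeffB mcoeff_eq0.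
  by apply/negP => /hph; rewrite mt ltxx.
split=> [/eqP h0|[m mp mt] h0]; last first.
  by move: mp; rewrite mcoeff_msupp (coefE _ mt) h0 mcoeff0 eqxx.
move: h0; rewrite -msupp_eq0; case E: (msupp h) => [//|m s] _.
have mh : m \in msupp h by rewrite E mem_head.
have mt := hh _ mh; exists m => //.
by rewrite mcoeff_msupp coefE // -mcoeff_msupp.
Qed.

Lemma mu_leadM s t p q h h' :
  mu_lead s p h -> mu_lead t q h' -> mu_lead (s + t) (p * q) (h * h').
Proof.
move=> lp lq; have [hh hph] := lp; have [hh' hqh'] := lq; split.
  by apply: degrees_inM hh hh' => x y -> ->.
(* In each term one factor is an error term, which makes the total degree strictly smaller; the
   other only has to respect its bound. *)
have -> : p * q - h * h' = (p - h) * q + h * (q - h').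
  by rewrite mulrBl mulrBr addrA subrK.
apply: degrees_inD.
  by apply: degrees_inM hph (mu_lead_le lq) => x y; apply: ltr_leD.
by apply: degrees_inM hh hqh' => x y ->; rewrite ltrD2l.
Qed.

Lemma mu_lead1 : mu_lead 0 1 1.
Proof.
split; last by rewrite subrr; apply: degrees_in0.
move=> m; rewrite -mpolyX0 => /mem_msuppXP <-.
by apply: big1 => i _; rewrite mnm0E mul0r.
Qed.

Lemma mu_leadX t p h e :
  mu_lead t p h -> mu_lead (e%:R * t) (p ^+ e) (h ^+ e).
Proof.
move=> lp; elim: e => [|e IHe]; first by rewrite mul0r !expr0; apply: mu_lead1.
by rewrite !exprS mulrS mulrDl mul1r; apply: mu_leadM.
Qed.

Lemma mu_lead_prod (I : Type) (s : seq I) (t : I -> R)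
    (p h : I -> {mpoly k[n]}) :
  (forall i, mu_lead (t i) (p i) (h i)) ->
  mu_lead (\sum_(i <- s) t i) (\prod_(i <- s) p i) (\prod_(i <- s) h i).
Proof.
move=> lph; elim: s => [|i s IHs]; first by rewrite !big_nil; apply: mu_lead1.
by rewrite !big_cons; apply: mu_leadM.
Qed.

Definition endo_lead t f g :=
  forall i, mu_lead (t * mu i) (tnth f i) (tnth g i).

(** Substituting f into a monomial of degree d gives degree at most s d, and its difference from the
    substitution of g is strictly lower. What p has besides q lies in degrees d < t, and s > 0 keeps
    s d < s t. *)
Lemma mu_lead_comp s t p q f g :
  0 < s -> mu_lead t p q -> endo_lead s f g ->
  mu_lead (s * t) (p \mPo f) (q \mPo g).
Proof.
move=> s0 [hq hpq] lf.
have lmon m : mu_lead (s * deg m) (\prod_(i < n) tnth f i ^+ m i)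
    (\prod_(i < n) tnth g i ^+ m i).
  rewrite mulr_sumr; apply: mu_lead_prod => i.
  by rewrite mulrCA; apply: mu_leadX.
split.
  rewrite comp_mpolyE; apply: degrees_in_sum => m /hq <-.
  by apply: degrees_inZ; case: (lmon m).
have -> : (p \mPo f) - (q \mPo g) =
    ((q \mPo f) - (q \mPo g)) + ((p - q) \mPo f).
  by rewrite comp_mpolyB [RHS]addrC addrA subrK.
apply: degrees_inD.
  rewrite !comp_mpolyE -sumrB; apply: degrees_in_sum => m /hq <-.
  by rewrite -scalerBr; apply: degrees_inZ; case: (lmon m).
rewrite comp_mpolyE; apply: degrees_in_sum => m /hpq mt.
apply: degrees_inZ; apply: degrees_inW (mu_lead_le (lmon m)) => x xle.
by rewrite (le_lt_trans xle) // ltr_pM2l.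
Qed.

Lemma endo_lead_id : endo_lead 1 (endo_id k n) (endo_id k n).
Proof.
move=> i; rewrite mul1r; split; last by rewrite subrr; apply: degrees_in0.
rewrite tnth_mktuple => m /mem_msuppXP <-.
rewrite /monomial_degree (bigD1 i) //= mnm1E eqxx mul1r big1 ?addr0 // => j ji.
by rewrite mnm1E eq_sym (negbTE ji) mul0r.
Qed.

Lemma endo_lead_comp s t f f' g g' :
  0 < t -> endo_lead s f f' -> endo_lead t g g' ->
  endo_lead (s * t) (endo_comp f g) (endo_comp f' g').
Proof.
move=> t0 lf lg i; rewrite !tnth_mktuple mulrAC mulrC.
exact: mu_lead_comp (lf i) lg.
Qed.

Lemma endo_lead_iter t f g r :
  0 < t -> endo_lead t f g ->
  endo_lead (t ^+ r) (endo_iter f r) (endo_iter g r).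
Proof.
move=> t0 lf; elim: r => [|r IHr]; first exact: endo_lead_id.
by rewrite exprS; apply: endo_lead_comp => //; rewrite exprn_gt0.
Qed.

End WeightedDegrees.

(** * Composition of endomorphisms and consequences of dominance *)

Section EndomorphismAlgebra.
Variables (k : fieldType) (n : nat).
Implicit Types (f g : endo k n).

Lemma comp_mpolyA (p : {mpoly k[n]}) f g :
  p \mPo endo_comp f g = (p \mPo f) \mPo g.
Proof.
rewrite !(comp_mpolyE p) raddf_sum; apply: eq_bigr => m _ /=.
rewrite comp_mpolyZ rmorph_prod; congr (_ *: _); apply: eq_bigr => i _.
by rewrite rmorphXn tnth_mktuple.
Qed.

Lemma endo_compA f g h :
  endo_comp f (endo_comp g h) = endo_comp (endo_comp f g) h.
Proof. by apply: eq_from_tnth => i; rewrite !tnth_mktuple comp_mpolyA. Qed.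

Lemma endo_comp1f f : endo_comp (endo_id k n) f = f.
Proof.
by apply: eq_from_tnth => i; rewrite !tnth_mktuple comp_mpolyXU -tnth_nth.
Qed.

Lemma endo_iterD f r s :
  endo_iter f (r + s) = endo_comp (endo_iter f r) (endo_iter f s).
Proof.
elim: r => [|r IHr]; first by rewrite endo_comp1f.
by rewrite addSn /= IHr endo_compA.
Qed.

(** If p vanishes after substituting f, the image of f lies in V(p). By density V(p) then contains
    the generic point, which is the zero ideal [O], so p = 0. *)
Lemma dominant_inj f (p : {mpoly k[n]}) : dominant f -> p \mPo f = 0 -> p = 0.
Proof.
move=> fdom pf0.
pose O : {pred {mpoly k[n]}} := pred1 0.
have zeroP : affine_space O.
  split; last by move=> u v; rewrite !inE mulf_eq0.
  split; rewrite ?inE ?eqxx ?oner_eq0 // => a u v; rewrite !inE.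
  by move=> /eqP-> /eqP->; rewrite mulr0 addr0.
have imf : (endo_point f @` @affine_space k n `<=` zero_locus [set p])%classic.
  move=> _ [Q [[Q0 Q1 QD] Qpr] <-]; split; last first.
    by move=> _ ->; rewrite inE pf0.
  split; last by move=> u v; rewrite !inE rmorphM; apply: Qpr.
  split; rewrite ?inE ?raddf0 ?rmorph1 // => a u v; rewrite !inE => hu hv.
  by rewrite rmorphD rmorphM; apply: QD.
have [_ /(_ p erefl)] := fdom _ imf _ zeroP.
by rewrite inE => /eqP.
Qed.

Lemma dominant_iter_inj f r (p : {mpoly k[n]}) :
  dominant f -> p \mPo endo_iter f r = 0 -> p = 0.
Proof.
move=> fdom; elim: r p => [|r IHr] p; first by rewrite comp_mpoly_id.
by rewrite /= comp_mpolyA => /IHr /(dominant_inj fdom).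
Qed.

Lemma endo_degree_leP f D :
  reflect (forall i m, m \in msupp (tnth f i) -> (mdeg m <= D)%N)
    (endo_degree f <= D)%N.
Proof.
have msizeP p : reflect (forall m : 'X_{1..n}, m \in msupp p -> (mdeg m <= D)%N)
    ((msize (p : {mpoly k[n]})).-1 <= D)%N.
  rewrite -subn1 leq_subLR add1n msizeE.
  by apply: (iffP (bigmax_leqP_seq _ _ _ _)) => [H m mp|H m mp _]; apply: H.
apply: (iffP (bigmax_leqP _ _ _)) => H i.
  by apply/msizeP/H.
by move=> _; apply/msizeP/H.
Qed.

(** In degree 0 some component of the iterate would be a constant c, and substitution would kill the
    nonzero polynomial x_i - c. The hypothesis on n provides a component. *)
Lemma endo_degree_iter_gt0 f r :
  (0 < n)%N -> dominant f -> (0 < endo_degree (endo_iter f r))%N.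
Proof.
move=> n0 fdom; rewrite ltnNge; apply/negP => /endo_degree_leP d0.
pose i := Ordinal n0; set q := tnth (endo_iter f r) i.
have qC : q = (q@_0%MM)%:MP.
  apply/mpolyP => m; rewrite mcoeffC; case: eqP => [->|/eqP m0].
    by rewrite mulr1.
  rewrite mulr0; apply: memN_msupp_eq0; apply/negP => /d0.
  by rewrite leqn0 mdeg_eq0 (negbTE m0).
have : 'X_i - (q@_0%MM)%:MP = 0 :> {mpoly k[n]}.
  apply: (@dominant_iter_inj f r) => //.
  by rewrite comp_mpolyB comp_mpolyXU comp_mpolyC -tnth_nth -/q -qC subrr.
move/(congr1 (mcoeff U_(i))) => /eqP.
rewrite mcoeffB mcoeffX eqxx mcoeffC mcoeff0 mnm1_eq0 mulr0 subr0.
by rewrite oner_eq0.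
Qed.

End EndomorphismAlgebra.

(** * Growth rates of subadditive and submultiplicative sequences *)

Lemma fekete (R : realType) (a : nat -> R) :
  (forall r, 0 <= a r) -> (forall r s, a (r + s)%N <= a r + a s) ->
  let E := [set a r / r%:R | r in [set r | (0 < r)%N]]%classic in
  (a r / r%:R @[r --> \oo] --> inf E)%classic.
Proof.
move=> a0 aD E.
have Elb : has_lbound E.
  by exists 0 => _ [r _ <-]; rewrite divr_ge0.
have Einf : has_inf E by split=> //; exists (a 1%N / 1), 1%N.
apply/cvgrPdist_le => e e0; have e20 : 0 < e / 2 by rewrite divr_gt0.
have [_ [s /= s0 <-] slt] := inf_adherent e20 Einf.
have sR : 0 < s%:R :> R by rewrite ltr0n.
(* As a is nonnegative, M bounds it at every remainder modulo s. Euclidean division of r by s then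
   gives a r / r <= a s / s + M / r, and the last term tends to 0. *)
pose M := \sum_(i < s) a i.
have aM q : forall j, (j < s)%N -> a (q * s + j)%N <= q%:R * a s + M.
  move=> j js; elim: q => [|q IHq].
    rewrite mul0n mul0r !add0r /M (bigD1 (Ordinal js)) //= lerDl.
    exact: sumr_ge0.
  rewrite mulSn -addnA (le_trans (aD _ _)) // mulrS mulrDl mul1r -addrA.
  by rewrite lerD2l.
near=> r.
have r0 : (0 < r)%N by near: r; exact: nbhs_infty_gt.
have rR : 0 < r%:R :> R by rewrite ltr0n.
have Er : inf E <= a r / r%:R by apply: ge_inf => //; exists r.
rewrite ler0_norm ?subr_le0 // opprB lerBlDr addrC.
have : a r / r%:R <= a s / s%:R + M / r%:R.
  rewrite ler_pdivrMr // mulrDl divfK ?gt_eqF //.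
  rewrite {1}(divn_eq r s) (le_trans (aM _ _ (ltn_pmod r s0))) // lerD2r.
  rewrite mulrAC ler_pdivlMr // mulrAC mulrC ler_wpM2l //.
  by rewrite -natrM ler_nat leq_divM.
move=> /le_trans; apply; rewrite [e]splitr addrA lerD //; first exact: ltW.
rewrite ler_pdivrMr // mulrC -ler_pdivrMr //.
by near: r; exact: nbhs_infty_ger.
Unshelve. all: by end_near. Qed.

Lemma le_of_powers_le (R : realType) (C x y : R) :
  0 < x -> 0 < y -> 0 < C -> (forall m, (0 < m)%N -> x ^+ m <= C * y ^+ m) ->
  x <= y.
Proof.
move=> x0 y0 C0 xyC; rewrite -ler_ln //; apply/ler_addgt0Pr => e e0.
(* The hypothesis reads m ln x <= ln C + m ln y, so it suffices that m e >= ln C. For negative ln C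
   the truncation is 0 and m = 1 works. *)
pose m := (Num.truncn (ln C / e)).+1.
have := xyC m isT; rewrite -ler_ln ?posrE ?mulr_gt0 ?exprn_gt0 //.
rewrite lnM ?posrE ?exprn_gt0 // !lnXn //.
rewrite -(mulr_natr (ln x)) -(mulr_natr (ln y)) => le_m.
have mR : 0 < m%:R :> R by rewrite ltr0n.
rewrite -(ler_pM2r mR) mulrDl (le_trans le_m) // addrC lerD2l.
by rewrite -ler_pdivrMl // mulrC ltW // truncnS_gt.
Qed.

Lemma submultiplicative_root_cvg (R : realType) (d : nat -> R) :
  (forall r, 1 <= d r) -> (forall r s, d (r + s)%N <= d r * d s) ->
  exists2 l : R, (d r `^ r%:R^-1 @[r --> \oo] --> l)%classic &
    (forall r, (0 < r)%N -> l ^+ r <= d r) /\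
    (forall x, 0 < x -> (forall r, (0 < r)%N -> x ^+ r <= d r) -> x <= l).
Proof.
move=> d1 dM; have d0 r : 0 < d r by apply: lt_le_trans (d1 r).
pose a r := ln (d r).
have aD r s : a (r + s)%N <= a r + a s.
  by rewrite -lnM ?posrE // ler_ln ?posrE ?mulr_gt0.
have a0 r : 0 <= a r by rewrite ln_ge0.
have acvg := fekete a0 aD.
set E : set R := [set a r / r%:R | r in _]%classic in acvg.
have Elb : has_lbound E.
  by exists 0 => _ [r _ <-]; rewrite divr_ge0.
(* The limit in Fekete's lemma is an infimum: being a lower bound gives l ^ r <= d r, and being the
   greatest one gives maximality of l. *)
exists (expR (inf E)); last split.
- have -> : (fun r => d r `^ r%:R^-1) = expR \o (fun r => a r / r%:R).
    by apply/funext => r; rewrite /powR gt_eqF //= mulrC.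
  by apply: continuous_cvg acvg; exact: continuous_expR.
- move=> r r0; rewrite -expRM_natr -[leRHS]lnK ?posrE // ler_expR.
  by rewrite -ler_pdivlMr ?ltr0n //; apply: ge_inf => //; exists r.
- move=> x x0 xd; rewrite -[x]lnK ?posrE // ler_expR.
  apply: lb_le_inf; first by exists (a 1%N / 1), 1%N.
  move=> _ [r /= r0 <-]; rewrite ler_pdivlMr ?ltr0n // mulr_natr -lnXn //.
  by rewrite ler_ln ?posrE ?exprn_gt0 // xd.
Qed.

(** * The weighted degree of an endomorphism and its comparison with the ordinary degree *)

Section EndoMuDegree.
Variables (R : realType) (k : fieldType) (n : nat) (mu : 'I_n -> R).
Hypothesis mu_gt0 : forall i, 0 < mu i.
Implicit Types (f : endo k n) (t : R).

Local Notation deg := (monomial_degree mu).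

Definition mu_bounded t f :=
  forall i, degrees_in mu (fun x => x <= t * mu i) (tnth f i).

Definition mu_attained t f :=
  exists i, exists2 m, m \in msupp (tnth f i) & deg m = t * mu i.

Lemma mu_degree_leP (p : {mpoly k[n]}) t :
  (mu_degree mu p <= t%:E)%E <-> degrees_in mu (fun x => x <= t) p.
Proof.
rewrite /mu_degree; split=> [H m mp|H].
  by rewrite -lee_fin (le_trans _ H) //; apply: le_bigmax_seq.
rewrite big_seq; apply: bigmax_le => [|m /H]; first exact: leNye.
by rewrite lee_fin.
Qed.

(** A monomial that attains the bound t rules out any smaller one. The alternative t = 0 serves the
    zero endomorphism, which has no monomials. *)
Lemma endo_mu_degreeE f t :
  0 <= t -> mu_bounded t f -> t = 0 \/ mu_attained t f ->
  endo_mu_degree mu f = t%:E.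
Proof.
move=> t0 bt at_; apply/eqP; rewrite eq_le; apply/andP; split.
  apply: ereal_inf_lbound; exists t => //; split=> // i.
  by apply/mu_degree_leP; apply: bt.
apply/ereal_infP => _ [s [s0 bs] <-]; rewrite lee_fin.
case: at_ => [->//|[i [m mf mt]]].
rewrite -(ler_pM2r (mu_gt0 i)) -mt.
by apply: (proj1 (mu_degree_leP _ _) (bs i)).
Qed.

Lemma endo_mu_degreeP f :
  exists t, [/\ endo_mu_degree mu f = t%:E, 0 <= t, mu_bounded t f
    & t = 0 \/ mu_attained t f].
Proof.
(* The monomial m of the i-th component forces a bound of at least [w i m]. There are finitely many
   such ratios, so the infimum is their maximum, cut off at 0. *)
pose w i m := deg m / mu i.
pose t := \big[Order.max/0]_(i < n)
  \big[Order.max/0]_(m <- msupp (tnth f i)) w i m.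
suff [t0 bt at_] : [/\ 0 <= t, mu_bounded t f & t = 0 \/ mu_attained t f].
  by exists t; split=> //; apply: endo_mu_degreeE.
split; first exact: bigmax_ge_id.
- move=> i m mf; rewrite -ler_pdivrMr //.
  apply: (le_trans _ (le_bigmax_seq _ _ _ _ (mem_index_enum i) isT)).
  exact: (le_bigmax_seq 0 m xpredT (w i)).
- have max_cases x y : Num.max x y = x \/ Num.max x y = y :> R.
    by rewrite /Num.max; case: ifP; [right|left].
  (* The maximum is 0 or one of the ratios: [K] holds for 0 and for each ratio, and is stable under
     binary maxima. *)
  pose K x := x = 0 \/ mu_attained x f.
  have Kmax x y : K x -> K y -> K (Num.max x y).
    by move=> Kx Ky; case: (max_cases x y) => ->.
  rewrite -/(K t) /t; elim/big_ind: _ => [|//|i _]; first by left.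
  rewrite big_seq; elim/big_ind: _ => [|//|m mf]; first by left.
  by right; exists i, m => //; rewrite /w divfK // gt_eqF.
Qed.

Lemma endo_mu_degree_attained f t :
  0 < t -> mu_bounded t f -> (endo_mu_degree mu f = t%:E <-> mu_attained t f).
Proof.
move=> t0 bt; split=> [|at_]; last first.
  by apply: endo_mu_degreeE; rewrite ?ltW //; right.
have [s [-> _ _ sat]] := endo_mu_degreeP f.
by move=> [st]; case: sat => [s0|]; [move: t0; rewrite -st s0 ltxx|rewrite st].
Qed.

Lemma mu_attained_le f s t :
  mu_attained s f -> mu_bounded t f -> s <= t.
Proof.
by move=> [i [m mf mt]] /(_ i m mf); rewrite mt ler_pM2r.
Qed.

Lemma mu_bounded_lead t f : mu_bounded t f ->
  endo_lead mu t f [tuple mu_homogeneous_part mu (t * mu j) (tnth f j) | j < n].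
Proof.
by move=> bt i; rewrite tnth_mktuple; apply: mu_lead_homogeneous_part.
Qed.

Lemma endo_lead_bounded t f g : endo_lead mu t f g -> mu_bounded t f.
Proof. by move=> lf i; apply: mu_lead_le (lf i). Qed.

Lemma endo_lead_attained t f g :
  endo_lead mu t f g -> (mu_attained t f <-> ~ endo_is0 g).
Proof.
move=> lf; split=> [[i mP]|/existsNP[i gi]].
  by move/(_ i); apply: (proj2 (mu_lead_neq0 (lf i)) mP).
by exists i; apply: (proj1 (mu_lead_neq0 (lf i)) gi).
Qed.

Lemma mu_bounded_id : mu_bounded 1 (endo_id k n).
Proof. exact: endo_lead_bounded (endo_lead_id k mu). Qed.

Lemma mu_bounded_comp s t f g :
  0 < t -> mu_bounded s f -> mu_bounded t g ->
  mu_bounded (s * t) (endo_comp f g).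
Proof.
move=> t0 bf bg; apply: endo_lead_bounded.
exact: endo_lead_comp t0 (mu_bounded_lead bf) (mu_bounded_lead bg).
Qed.

Lemma mu_bounded_iter s t f m : 0 < t ->
  mu_bounded t (endo_iter f s) -> mu_bounded (t ^+ m) (endo_iter f (s * m)).
Proof.
move=> t0 bt; elim: m => [|m IHm]; first by rewrite muln0; apply: mu_bounded_id.
rewrite mulnS endo_iterD exprS.
by apply: mu_bounded_comp; rewrite ?exprn_gt0.
Qed.

(** From mu_i <= b and 1 <= c mu_i, passing between weighted and ordinary degrees of a monomial
    costs a factor b or c, and passing between t mu_i and t costs the other one. Hence C = b c. *)
Lemma mu_degree_comparable : exists2 C : R, 0 < C &
  (forall f t, 0 <= t -> mu_bounded t f -> (endo_degree f)%:R <= C * t) /\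
  (forall f t, 0 < t -> mu_attained t f -> t <= C * (endo_degree f)%:R).
Proof.
pose b := 1 + \sum_i mu i; pose c := 1 + \sum_i (mu i)^-1.
have b0 : 0 < b by rewrite ltr_wpDr // sumr_ge0 // => i _; apply: ltW.
have c0 : 0 < c.
  by rewrite ltr_wpDr // sumr_ge0 // => i _; rewrite invr_ge0 ltW.
have mub i : mu i <= b.
  rewrite /b (bigD1 i) //= addrCA lerDl addr_ge0 // sumr_ge0 // => j _.
  exact: ltW.
have muc i : 1 <= c * mu i.
  rewrite -ler_pdivrMr // div1r /c (bigD1 i) //= addrCA lerDl addr_ge0 //.
  by rewrite sumr_ge0 // => j _; rewrite invr_ge0 ltW.
have mdeg_sum (m : 'X_{1..n}) : (mdeg m)%:R = \sum_i (m i)%:R :> R.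
  by rewrite mdegE natr_sum.
exists (b * c); first exact: mulr_gt0.
split=> f t t0 H.
  have Ct0 : 0 <= b * c * t by rewrite mulr_ge0 // ltW // mulr_gt0.
  (* The ordinary degree is a natural number, so the real bound is truncated in order to check it
     monomial by monomial. *)
  rewrite -(truncn_ge_nat _ Ct0); apply/endo_degree_leP => i m mf.
  rewrite truncn_ge_nat //.
  have : (mdeg m)%:R <= c * deg m.
    rewrite mdeg_sum mulr_sumr; apply: ler_sum => j _.
    by rewrite mulrCA -[leLHS]mulr1 ler_wpM2l.
  move=> /le_trans; apply; rewrite (mulrC b) -mulrA ler_pM2l //.
  by rewrite (le_trans (H i m mf)) // mulrC ler_wpM2r.
case: H => i [m mf mt].
have : t <= c * deg m.
  by rewrite mt mulrCA -[leLHS]mulr1 ler_pM2l.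
move=> /le_trans; apply; rewrite (mulrC b) -mulrA ler_pM2l //.
apply: (@le_trans _ _ (b * (mdeg m)%:R)).
  rewrite mdeg_sum mulr_sumr; apply: ler_sum => j _.
  by rewrite mulrC ler_wpM2r.
rewrite ler_pM2l // ler_nat.
by have /endo_degree_leP := leqnn (endo_degree f); apply; exact: mf.
Qed.

End EndoMuDegree.

(** * Ordinary degrees of iterates and bounds for the dynamical degree *)

Lemma monomial_degree1 (R : realType) n (m : 'X_{1..n}) :
  monomial_degree (fun=> 1 : R) m = (mdeg m)%:R.
Proof.
by rewrite mdegE natr_sum; apply: eq_bigr => i _; rewrite mulr1.
Qed.

(** With all weights equal to 1, submultiplicativity of the ordinary degree becomes a case of
    [mu_bounded_comp]. *)
Lemma mu_bounded1 (R : realType) (k : fieldType) n (f : endo k n) D :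
  mu_bounded (fun=> 1 : R) D%:R f <-> (endo_degree f <= D)%N.
Proof.
split=> [H|/endo_degree_leP H i m mf].
  apply/endo_degree_leP => i m mf.
  by have := H i m mf; rewrite monomial_degree1 mulr1 ler_nat.
by rewrite monomial_degree1 mulr1 ler_nat (H i).
Qed.

Section DominantIterates.
Variables (R : realType) (k : fieldType) (n : nat) (f : endo k n).
Hypotheses (n_gt0 : (0 < n)%N) (f_dominant : dominant f).

Let d r : R := (endo_degree (endo_iter f r))%:R.

Let d_ge1 r : 1 <= d r.
Proof. by rewrite ler1n endo_degree_iter_gt0. Qed.

Let d_submul r s : d (r + s)%N <= d r * d s.
Proof.
rewrite /d -natrM ler_nat endo_iterD; apply/(mu_bounded1 R); rewrite natrM.
apply: mu_bounded_comp.
- by rewrite ltr0n endo_degree_iter_gt0.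
- exact/mu_bounded1.
- exact/mu_bounded1.
Qed.

(** This extremal description replaces the limit in everything that follows. *)
Lemma dynamical_degreeP :
  [/\ 1 <= dynamical_degree R f,
      forall r, (0 < r)%N -> dynamical_degree R f ^+ r <= d r
    & forall x, 0 < x -> (forall r, (0 < r)%N -> x ^+ r <= d r) ->
        x <= dynamical_degree R f].
Proof.
have [l dl [ld lmax]] := submultiplicative_root_cvg d_ge1 d_submul.
have -> : dynamical_degree R f = l by apply/cvg_lim: dl.
by split=> //; apply: lmax => // r _; rewrite expr1n.
Qed.

Lemma degree_iterM s m : d (s * m)%N <= d s ^+ m.
Proof.
rewrite /d -natrX ler_nat; apply/(mu_bounded1 R); rewrite natrX.
apply: mu_bounded_iter.
- by rewrite ltr0n endo_degree_iter_gt0.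
- exact/mu_bounded1.
Qed.

Variable mu : 'I_n -> R.
Hypothesis mu_gt0 : forall i, 0 < mu i.

(** The ordinary degree of an iterate is at least 1 and at most C t. *)
Lemma mu_bounded_iter_gt0 t r :
  0 <= t -> mu_bounded mu t (endo_iter f r) -> 0 < t.
Proof.
have [C C0 [le_d _]] := mu_degree_comparable k mu_gt0.
move=> t0 /(le_d _ _ t0) dt; rewrite -(pmulr_rgt0 _ C0).
exact: lt_le_trans (lt_le_trans ltr01 (d_ge1 r)) dt.
Qed.

Lemma dynamical_degree_le s t :
  (0 < s)%N -> 0 <= t -> mu_bounded mu t (endo_iter f s) ->
  dynamical_degree R f ^+ s <= t.
Proof.
move=> s0 t0 bt; have tgt0 := mu_bounded_iter_gt0 t0 bt.
have [C C0 [le_d _]] := mu_degree_comparable k mu_gt0.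
have [l1 ld _] := dynamical_degreeP.
apply: (le_of_powers_le _ tgt0 C0) => [|m m0].
  by rewrite exprn_gt0 // (lt_le_trans ltr01).
rewrite -exprM (le_trans (ld _ _)) ?muln_gt0 ?s0 //.
by apply: le_d; [rewrite exprn_ge0|apply: mu_bounded_iter].
Qed.

(** For fixed s and all m, t^(s m) <= C deg(f^(s m)) <= C deg(f^s)^m. Letting m grow removes C, so
    t^s <= deg(f^s), and maximality of lambda applies. *)
Lemma dynamical_degree_ge t :
  0 < t -> (forall r, (0 < r)%N -> mu_attained mu (t ^+ r) (endo_iter f r)) ->
  t <= dynamical_degree R f.
Proof.
move=> t0 att; have [C C0 [_ ge_d]] := mu_degree_comparable k mu_gt0.
have [_ _] := dynamical_degreeP; apply=> // s s0.
apply: (le_of_powers_le (C := C)) => [|||m m0]; rewrite ?exprn_gt0 //.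
  by rewrite (lt_le_trans ltr01) // d_ge1.
rewrite -exprM (le_trans (ge_d _ _ _ (att _ _))) ?exprn_gt0 ?muln_gt0 ?s0 //.
by rewrite ler_pM2l // degree_iterM.
Qed.

End DominantIterates.

Theorem proposition1 (R : realType) (k : fieldType) (n : nat) (hn : (1 <= n)%N)
    (f : endo k n) (hf : dominant f)
    (mu : 'I_n -> R) (hmu : forall i : 'I_n, 0 < mu i) :
  let theta := endo_mu_degree mu f in
  let lambda := dynamical_degree R f in
  let g := mu_leading_part mu f in
  [/\ (theta < +oo)%E,
      1 <= lambda /\ (lambda%:E <= theta)%E
    & (1 < theta)%E ->
      (lambda%:E = theta <-> mu_algebraically_stable mu f) /\
      (mu_algebraically_stable mu f <->
         forall r : nat, (1 <= r)%N -> ~ endo_is0 (endo_iter g r))].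
Proof.
move=> theta lambda g.
have [t [tE t0 bt _]] := endo_mu_degreeP hmu f.
have iter1 : endo_iter f 1 = f.
  by apply: eq_from_tnth => i; rewrite tnth_mktuple comp_mpoly_id.
have bt1 : mu_bounded mu t (endo_iter f 1) by rewrite iter1.
have tgt0 := mu_bounded_iter_gt0 hn hf hmu t0 bt1.
have lam_le : lambda <= t.
  by have := dynamical_degree_le hn hf hmu (ltn0Sn 0) t0 bt1; rewrite expr1.
have [lam1 _ _] := dynamical_degreeP R hn hf.
have gE : g = [tuple mu_homogeneous_part mu (t * mu j) (tnth f j) | j < n].
  by rewrite /g /mu_leading_part tE.
have lead_iter r := endo_lead_iter r tgt0 (mu_bounded_lead bt).
rewrite -gE in lead_iter.
have bounded_iter r := endo_lead_bounded (lead_iter r).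
(* The iterate f^r always respects the bound t^r, so stability says exactly that each of these
   bounds is attained. *)
have stableE : mu_algebraically_stable mu f <->
    forall r, (1 <= r)%N -> mu_attained mu (t ^+ r) (endo_iter f r).
  have attE r : endo_mu_degree mu (endo_iter f r) = (theta ^+ r)%E <->
      mu_attained mu (t ^+ r) (endo_iter f r).
    rewrite /theta tE -EFin_expe; apply: endo_mu_degree_attained => //.
    exact: exprn_gt0.
  split=> [[_ H] r /H /attE //|H]; split=> [|r /H /attE //].
  by rewrite /theta tE ltry.
rewrite (propext stableE); split; rewrite ?/theta ?tE ?ltry ?lee_fin //.
move=> _; split; last first.
  by split=> H r /H /(endo_lead_attained (lead_iter r)).
split=> [[lamE] r r0|H]; last first.
  congr _%:E; apply/eqP; rewrite eq_le lam_le /=.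
  exact: dynamical_degree_ge H.
(* Let s be the weighted degree of f^r. It is squeezed by t^r = lambda^r <= s <= t^r. *)
have [s [_ s0 bs sat]] := endo_mu_degreeP hmu (endo_iter f r).
have sgt0 := mu_bounded_iter_gt0 hn hf hmu s0 bs.
have {}sat : mu_attained mu s (endo_iter f r).
  by case: sat sgt0 => [->|//]; rewrite ltxx.
suff -> : t ^+ r = s by [].
apply/eqP; rewrite eq_le (mu_attained_le hmu sat (bounded_iter r)) andbT.
by rewrite -lamE; apply: dynamical_degree_le bs.
Qed.
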